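(* Let $\|\cdot\|$ be any norm on $\mathbb{R}^n$ and let $\mathcal{A}$ be a real symmetric tensor of order $m$ and dimension $n$. Then $\mathcal{A}$ is strictly copositive if and only if there is a real number $\gamma\ge 0$ such that $$\mathcal{A}x^m+\gamma\|x^-\|^m>0\quad\text{for all }x\in\mathbb{R}^n\setminus\{0\}.$$
   Context: Let $m,n$ be positive integers. A real tensor of order $m$ and dimension $n$ is an array $\mathcal{A}=(a_{i_1\cdots i_m})$ with $a_{i_1\cdots i_m}\in\mathbb{R}$, $1\le i_1,\dots,i_m\le n$. It is symmetric if its entries are invariant under every permutation of the indices. For $x\in\mathbb{R}^n$, $\mathcal{A}x^m=\sum_{i_1,\dots,i_m=1}^n a_{i_1\cdots i_m}x_{i_1}\cdots x_{i_m}$. $\mathbb{R}^n_+=\{x\in\mathbb{R}^n: x_i\ge 0 \text{ for all } i\}$. $\mathcal{A}$ is strictly copositive if $\mathcal{A}x^m>0$ for all $x\in\mathbb{R}^n_+\setminus\{0\}$. For $x\in\mathbb{R}^n$, $x^-=(x_1^-,\dots,x_n^-)^T$ with $x_i^-=\max\{-x_i,0\}$. *)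

(* Defs.v *)
From mathcomp Require Import all_boot all_order all_fingroup all_algebra reals.

Set Implicit Arguments.
Unset Strict Implicit.
Unset Printing Implicit Defensive.

Import Order.TTheory GRing.Theory Num.Theory.
Local Open Scope ring_scope.

(* A multi-index (i_1, ..., i_m) is a finite function 'I_m -> 'I_n, so the
   entry a_{i_1 ... i_m} of A is A i. *)
Definition tensor (R : realType) (m n : nat) : Type :=
  {ffun {ffun 'I_m -> 'I_n} -> R}.

Definition symmetric_tensor (R : realType) (m n : nat) (A : tensor R m n) :
    Prop :=
  forall (s : 'S_m) (i : {ffun 'I_m -> 'I_n}), A [ffun k => i (s k)] = A i.

(* A x^m *)
Definition tensor_form (R : realType) (m n : nat) (A : tensor R m n)
    (x : 'cV[R]_n) : R :=
  \sum_(i : {ffun 'I_m -> 'I_n}) A i * \prod_(k < m) x (i k) 0.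

Definition nonneg_orthant (R : realType) (n : nat) (x : 'cV[R]_n) : Prop :=
  forall i : 'I_n, 0 <= x i 0.

Definition strictly_copositive (R : realType) (m n : nat) (A : tensor R m n) :
    Prop :=
  forall x : 'cV[R]_n, nonneg_orthant x -> x <> 0 -> 0 < tensor_form A x.

(* x^- *)
Definition neg_part (R : realType) (n : nat) (x : 'cV[R]_n) : 'cV[R]_n :=
  \col_i Num.max (- x i 0) 0.

(* MathComp attaches norms to types (normedZmodType), with a canonical choice,
   the sup norm, on matrices; an arbitrary norm on R^n is therefore a function
   satisfying the axioms. *)
Record is_norm (R : realType) (n : nat) (N : 'cV[R]_n -> R) : Prop := IsNorm {
  is_norm_ge0 : forall x, 0 <= N x;
  is_norm_eq0 : forall x, N x = 0 -> x = 0;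
  is_normZ : forall (a : R) x, N (a *: x) = `|a| * N x;
  is_normD : forall x y, N (x + y) <= N x + N y
}.

(* Main.v *)
Require Import Defs.
From mathcomp Require Import all_boot all_order all_fingroup all_algebra reals.
From mathcomp Require Import boolp classical_sets topology normedtype derive.

(** Both terms are homogeneous of degree m, so it suffices to find gamma on the
    unit sphere S, which is compact. If A is strictly copositive, then at each
    point of S either A x^m > 0 or x^- <> 0, so the continuous function
    max (A x^m, ||x^-||) has a positive minimum d on S, while A x^m has a
    minimum c; then gamma = |c| / d^m + 1 works, because ||x^-|| >= d wherever
    A x^m < d. *)

Import Order.TTheory GRing.Theory Num.Theory.
Import numFieldNormedType.Exports.
Local Open Scope ring_scope.
Local Open Scope classical_set_scope.

Section NormOfColumns.
Context {R : realType} {n : nat} {N : 'cV[R]_n -> R} (normN : is_norm N).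

Lemma is_norm0 : N 0 = 0.
Proof. by rewrite -(scale0r 0) (is_normZ normN) normr0 mul0r. Qed.

Lemma is_norm_gt0 x : x <> 0 -> 0 < N x.
Proof.
move=> x0; rewrite lt_def (is_norm_ge0 normN) andbT.
by apply/eqP => /(is_norm_eq0 normN).
Qed.

Lemma is_norm_sum (I : finType) (f : I -> 'cV[R]_n) :
  N (\sum_i f i) <= \sum_i N (f i).
Proof.
elim/big_ind2: _ => [|x a y b xa yb|//]; first by rewrite is_norm0.
by apply: le_trans (is_normD normN _ _) _; exact: lerD.
Qed.

Lemma is_norm_dist x y : `|N x - N y| <= N (x - y).
Proof.
have le_sub u v : N u - N v <= N (u - v).
  by rewrite lerBlDr -{1}(subrK v u) (is_normD normN).
rewrite ler_norml le_sub andbT lerNl opprB.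
by apply: le_trans (le_sub y x) _; rewrite -opprB -scaleN1r (is_normZ normN)
  normrN1 mul1r.
Qed.

Lemma is_norm_le_coord x :
  N x <= \sum_i `|x i 0| * N (delta_mx i 0).
Proof.
rewrite {1}(matrix_sum_delta x); apply: le_trans (is_norm_sum _ _) _.
by apply: ler_sum => i _; rewrite big_ord1 (is_normZ normN).
Qed.

(** This makes an arbitrary norm continuous for the sup-norm topology: [|N x - N y|] is at most
    [N (x - y)], hence at most a fixed weighted sum of the coordinate distances. *)
Lemma is_norm_cvg (T : Type) (F : set_system T) (FF : Filter F)
    (g : T -> 'cV[R]_n) (l : 'cV[R]_n) :
  (forall i, g t i 0 @[t --> F] --> l i 0) -> N (g t) @[t --> F] --> N l.
Proof.
move=> gl; apply/subr_cvg0/norm_cvg0P.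
apply: (@squeeze_cvgr _ _ _ _ (fun=> 0)
    (fun t => \sum_i `|g t i 0 - l i 0| * N (delta_mx i 0))).
- apply: nearW => t; rewrite normr_ge0 (le_trans (is_norm_dist _ _))//.
  apply: le_trans (is_norm_le_coord _) _.
  by under eq_bigr do rewrite !mxE.
- exact: cvg_cst.
(* The limit 0 is rewritten as a sum of zeros so that the limit can be taken term by term. *)
rewrite -[X in _ --> X](@big1_eq _ _ +%R _ (index_enum 'I_n) xpredT).
apply: cvg_big => [|i _]; first exact: add_continuous.
rewrite -[X in _ --> X](mul0r (N (delta_mx i 0))).
apply: cvgM; last exact: cvg_cst.
by apply/norm_cvg0P/subr_cvg0.
Qed.

End NormOfColumns.

Lemma tensor_formZ (R : realType) (m n : nat) (A : tensor R m n) (a : R) x :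
  tensor_form A (a *: x) = a ^+ m * tensor_form A x.
Proof.
rewrite /tensor_form mulr_sumr; apply: eq_bigr => i _.
under eq_bigr do rewrite mxE.
by rewrite big_split /= prodr_const card_ord mulrCA.
Qed.

Lemma tensor_form_tr_continuous (R : realType) (m n : nat) (A : tensor R m n) :
  continuous (fun v : 'rV[R]_n => tensor_form A v^T).
Proof.
apply: (@continuous_big _ _ _ _ _ (@add_continuous R) _ _
  (fun i (v : 'rV[R]_n) => A i * \prod_(k < m) v^T (i k) 0)) => i _ v.
apply: (@continuousM _ _ (fun=> A i)); first exact: cst_continuous.
move: v; apply: (@continuous_big _ _ _ _ _ (@mul_continuous R) _ _
  (fun k (v : 'rV[R]_n) => v^T (i k) 0)) => k _ v; rewrite /continuous_at mxE.
by under eq_cvg do rewrite mxE; exact: coord_continuous.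
Qed.

Lemma neg_partZ (R : realType) (n : nat) (a : R) (x : 'cV[R]_n) :
  0 <= a -> neg_part (a *: x) = a *: neg_part x.
Proof.
by move=> a0; apply/colP => i; rewrite !mxE maxr_pMr// mulr0 mulrN.
Qed.

Lemma neg_part_eq0 (R : realType) (n : nat) (x : 'cV[R]_n) :
  neg_part x = 0 <-> nonneg_orthant x.
Proof.
split=> [/colP x0 i|x0]; last first.
  by apply/colP => i; rewrite !mxE max_r// oppr_le0.
by have := x0 i; rewrite !mxE => /eqP; rewrite eq_maxr oppr_le0.
Qed.

Lemma neg_part_tr_norm_continuous (R : realType) (n : nat)
    (N : 'cV[R]_n -> R) (normN : is_norm N) :
  continuous (fun v : 'rV[R]_n => N (neg_part v^T)).
Proof.
move=> v; apply: (is_norm_cvg normN _ _ (nbhs_filter v)) => i.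
under eq_cvg do rewrite !mxE.
rewrite !mxE; apply: (@continuous_max _ _ (fun w : 'rV[R]_n => - w 0 i)).
  by apply: continuousN; exact: coord_continuous.
exact: cst_continuous.
Qed.

(** The sphere is that of the sup norm, which defines the topology, and not of [N]. Row vectors are
    the setting of [bounded_closed_compact], hence the transposes. *)
Lemma unit_sphere_compact (R : realType) (n : nat) :
  compact [set v : 'rV[R]_n | `|v| = 1].
Proof.
apply: bounded_closed_compact.
  by exists 1; split=> // M M1 v /= ->; exact: ltW.
have /continuous_closedP normC := @norm_continuous R 'rV[R]_n.
exact: (normC [set x | x = 1] (@closed_eq R 1)).
Qed.

Theorem theorem3p2 (R : realType) (m n : nat) (m_gt0 : (0 < m)%N)
    (n_gt0 : (0 < n)%N) (N : 'cV[R]_n -> R) (normN : is_norm N)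
    (A : tensor R m n) (symA : symmetric_tensor A) :
  strictly_copositive A <->
  exists gamma : R, 0 <= gamma /\
    forall x : 'cV[R]_n, x <> 0 ->
      0 < tensor_form A x + gamma * N (neg_part x) ^+ m.
Proof.
split=> [copA|[gamma [_ posA]] x x0 xn0]; last first.
  have := posA x xn0; rewrite (neg_part_eq0 _ _ x).2//.
  (* Positivity of [m] is what makes [0 ^+ m] vanish. *)
  by rewrite (is_norm0 normN) expr0n gtn_eqF// mulr0 addr0.
pose S := [set v : 'rV[R]_n | `|v| = 1].
pose f (v : 'rV[R]_n) := tensor_form A v^T.
pose h (v : 'rV[R]_n) := N (neg_part v^T).
have unitS v : v != 0 -> S (`|v|^-1 *: v).
  by move=> v0; rewrite /S /= normrZ normfV normr_id mulVf ?normr_eq0.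
have S0 : S !=set0.
  exists (`|const_mx 1 : 'rV[R]_n|^-1 *: const_mx 1); apply: unitS.
  by apply/eqP => /rowP/(_ (Ordinal n_gt0))/eqP; rewrite !mxE oner_eq0.
have fC : continuous f by exact: tensor_form_tr_continuous.
have hC : continuous h by exact: neg_part_tr_norm_continuous.
(* Here [c] and, below, [d] are points where the minima are attained; the minimum values are [f c]
   and [e]. *)
have [|c _ cP] := compact_EVT_min S0 (@unit_sphere_compact R n) (f := f).
  exact: continuous_subspaceT.
have [|d dS dP] := compact_EVT_min S0 (@unit_sphere_compact R n)
    (f := fun v => Num.max (f v) (h v)).
  by apply: continuous_subspaceT => v; apply: (continuous_max (fC v) (hC v)).
set e := Num.max (f d) (h d) in dP.
have e_gt0 : 0 < e.
  rewrite lt_max; have [/neg_part_eq0 dn|dn] := pselect (neg_part d^T = 0).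
    rewrite copA// => d0; move: dS; rewrite inE /S /= -(trmxK d) d0 trmx0.
    by rewrite normr0 => /esym/eqP; rewrite oner_eq0.
  by rewrite orbC /h (is_norm_gt0 normN).
have em_gt0 : 0 < e ^+ m by rewrite exprn_gt0.
(* Chosen so that [gamma * e ^+ m] equals [|f c| + e ^+ m]: the first term offsets the least value
   of [f], the second makes the inequality strict. *)
pose gamma := `|f c| / e ^+ m + 1.
have gamma_ge0 : 0 <= gamma by rewrite addr_ge0// divr_ge0// ltW.
have posS v : S v -> 0 < f v + gamma * h v ^+ m.
  move=> Sv; have h0 : 0 <= h v by exact: is_norm_ge0 normN _.
  have vS : v \in S by rewrite inE.
  (* Either [e <= f v] and the form is already positive, or [e <= h v] and the penalty outweighs
     [f v >= - |f c|]. *)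
  have := dP v vS; rewrite le_max => /orP[ev|ev].
    by rewrite ltr_pwDl ?(lt_le_trans e_gt0)// mulr_ge0// exprn_ge0.
  have : gamma * e ^+ m <= gamma * h v ^+ m.
    by rewrite ler_wpM2l// lerXn2r ?nnegrE// ltW.
  rewrite mulrDl mul1r divfK ?gt_eqF// => gh.
  rewrite (lt_le_trans em_gt0)// -lerBlDl; apply: le_trans gh.
  rewrite addrC lerD2r lerNl; apply: le_trans (cP v vS).
  by rewrite lerNl -normrN ler_norm.
exists gamma; split=> // x /eqP x0.
have xT0 : x^T != 0 by rewrite -trmx0 (inj_eq trmx_inj).
have r0 : 0 < `|x^T|^-1 by rewrite invr_gt0 normr_gt0.
(* Normalizing [x] multiplies both terms by the same positive factor, the [m]-th power of the
   inverse sup norm, which is then cancelled. *)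
have := posS _ (unitS _ xT0).
rewrite /f /h linearZ /= trmxK tensor_formZ neg_partZ ?ltW//.
rewrite (is_normZ normN) gtr0_norm// exprMn mulrCA -mulrDr.
by rewrite pmulr_rgt0// exprn_gt0.
Qed.
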